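(* Let $\tau$ be a measurable cardinal, let $\mathcal{U}$ be a $\tau$-complete free ultrafilter on $\tau$, and let $X=\tau\cup\{\mathcal{U}\}$ with the subspace topology inherited from the Čech–Stone compactification $\beta\tau$ of the discrete space $\tau$. Then $X$ is countably $\varkappa$-metrizable but not $\varkappa$-metrizable.
   Context: All spaces are Tychonoff. An ultrafilter $\mathcal{U}$ on $\tau$ is $\tau$-complete if $\bigcap\mathcal{A}\in\mathcal{U}$ whenever $\mathcal{A}\subseteq\mathcal{U}$ and $|\mathcal{A}|<\tau$. An uncountable cardinal $\tau$ is measurable if there is a $\tau$-complete free ultrafilter on $\tau$. The points of $\beta\tau$ are the ultrafilters on $\tau$, with $\tau$ identified with the principal ones; thus in $X$ the points of $\tau$ are isolated and the basic neighbourhoods of $\mathcal{U}$ are the sets $D\cup\{\mathcal{U}\}$, $D\in\mathcal{U}$. For a space $X$, $\mathrm{RC}(X)$ is the set of regular closed subsets of $X$ (sets $A$ with $\mathrm{cl}\,\mathrm{int}\,A=A$). A $\varkappa$-metric on $X$ is a function $\varrho:X\times \mathrm{RC}(X)\to[0,\infty)$ such that: (K1) $\varrho(x,C)=0$ if and only if $x\in C$, for all $x\in X$, $C\in\mathrm{RC}(X)$; (K2) if $C\subseteq D$ then $\varrho(x,C)\ge\varrho(x,D)$, for all $x\in X$, $C,D\in\mathrm{RC}(X)$; (K3) $\varrho(\cdot,C)$ is continuous for every $C\in\mathrm{RC}(X)$; (K4) $\varrho(x,\mathrm{cl}(\bigcup_{\alpha<\lambda}C_\alpha))=\inf_{\alpha<\lambda}\varrho(x,C_\alpha)$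 for every non-decreasing totally ordered sequence $\{C_\alpha:\alpha<\lambda\}\subseteq\mathrm{RC}(X)$ and every $x\in X$. A countable $\varkappa$-metric is a function $\varrho:X\times\mathrm{RC}(X)\to[0,\infty)$ satisfying (K1)–(K3) and (K4$_\omega$) $\varrho(x,\mathrm{cl}(\bigcup_{n<\omega}C_n))=\inf_{n<\omega}\varrho(x,C_n)$ for every chain $\{C_n:n<\omega\}\subseteq\mathrm{RC}(X)$ and every $x\in X$. $X$ is $\varkappa$-metrizable (resp. countably $\varkappa$-metrizable) if it admits a $\varkappa$-metric (resp. a countable $\varkappa$-metric). *)

(* Defs.v *)
From HB Require Import structures.
From mathcomp Require Import all_boot all_order all_algebra.
From mathcomp Require Import all_classical all_reals topology.
From mathcomp Require Import normedtype.
From mathcomp Require wochoice.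

Set Implicit Arguments.
Unset Strict Implicit.
Unset Printing Implicit Defensive.

Import Order.TTheory GRing.Theory Num.Theory.
Import numFieldNormedType.Exports.

Local Open Scope classical_set_scope.
Local Open Scope ring_scope.
Local Open Scope card_scope.

(* A cardinal is represented by an arbitrary type T of that cardinality. *)

Definition card_lt (T U : Type) (A : set T) (B : set U) : Prop :=
  (A #<= B) /\ ~ (B #<= A).

Definition tau_complete (T : Type) (F : set_system T) : Prop :=
  forall A : set (set T), A `<=` F -> card_lt A [set: T] ->
    F (\bigcap_(D in A) D).

Definition free_filter (T : Type) (F : set_system T) : Prop :=
  \bigcap_(D in F) D = set0.

Definition measurable_cardinal (T : Type) : Prop :=
  ~ countable [set: T] /\
  exists F : set_system T, [/\ UltraFilter F, tau_complete F & free_filter F].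

(* The Cech-Stone compactification of the discrete space T: the ultrafilters
   on T, topologized with the sets beta_base D, D : set T, as a base. *)
Record betaT (T : Type) := BetaT {
  beta_sets :> set_system T;
  beta_ultra : UltraFilter beta_sets }.

HB.instance Definition _ (T : Type) := gen_eqMixin (betaT T).
HB.instance Definition _ (T : Type) := gen_choiceMixin (betaT T).

Definition beta_base (T : Type) (D : set T) : set (betaT T) :=
  [set p | beta_sets p D].

Lemma beta_base_cover (T : Type) :
  \bigcup_(D in [set: set T]) beta_base D = setT.
Proof.
by apply/seteqP; split=> // -[F FU] _; exists setT => //; exact: filterT.
Qed.

Lemma beta_base_join (T : Type) (D E : set T) (p : betaT T) :
  [set: set T] D -> [set: set T] E -> beta_base D p -> beta_base E p ->
  exists K, [/\ [set: set T] K, beta_base K p &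
    beta_base K `<=` beta_base D `&` beta_base E].
Proof.
move=> _ _; case: p => [F FU] FD FE; exists (D `&` E); split => //.
  exact: filterI FD FE.
by move=> [G GU] GDE; split; apply: filterS GDE => x [].
Qed.

HB.instance Definition _ (T : Type) :=
  isBaseTopological.Build (betaT T) (@beta_base_cover T) (@beta_base_join T).

Definition principal (T : Type) (t : T) : betaT T :=
  BetaT (principal_filter_ultra t).

(* T together with the point U; coerced to a type, this set carries the
   topology induced by betaT T. *)
Definition adjoin_ultra (T : Type) (U : betaT T) : set (betaT T) :=
  range (@principal T) `|` [set U].

(* In the two definitions below rho is a function on X * RC(X), encoded as a
   total function of which only the values at regular closed sets matter. *)

Definition kappa_K1_K3 (R : realType) (X : topologicalType)
    (rho : X -> set X -> R) : Prop :=
  [/\ forall x C, regclosed C -> 0 <= rho x C,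
      forall x C, regclosed C -> (rho x C = 0 <-> C x),
      forall x C D, regclosed C -> regclosed D -> C `<=` D ->
        rho x D <= rho x C &
      forall C, regclosed C -> continuous (fun x => rho x C)].

(* The index ordinal of (K4) is an arbitrary nonempty well-ordered type; it
   is nonempty because the infimum of the empty set is not defined. *)
Definition kappa_metric (R : realType) (X : topologicalType)
    (rho : X -> set X -> R) : Prop :=
  kappa_K1_K3 rho /\
  forall (I : Type) (le : rel I) (C : I -> set X),
    wochoice.well_order le -> [set: I] !=set0 ->
    (forall i, regclosed (C i)) ->
    (forall i j, le i j -> C i `<=` C j) ->
    forall x, rho x (closure (\bigcup_i C i)) = inf [set rho x (C i) | i in setT].

Definition countable_kappa_metric (R : realType) (X : topologicalType)
    (rho : X -> set X -> R) : Prop :=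
  kappa_K1_K3 rho /\
  forall C : nat -> set X,
    (forall n, regclosed (C n)) ->
    (forall m n, C m `<=` C n \/ C n `<=` C m) ->
    forall x, rho x (closure (\bigcup_n C n)) = inf [set rho x (C n) | n in setT].

Definition kappa_metrizable (R : realType) (X : topologicalType) : Prop :=
  exists rho : X -> set X -> R, kappa_metric rho.

Definition countably_kappa_metrizable (R : realType) (X : topologicalType)
  : Prop := exists rho : X -> set X -> R, countable_kappa_metric rho.

(* Main.v *)
Require Import Defs.
From mathcomp Require Import all_boot all_order all_algebra.
From mathcomp Require Import all_classical all_reals topology normedtype.
From mathcomp Require wochoice.

(* The regular closed subsets of X are clopen, and each is determined by its
   trace on T.  Countable completeness makes countable unions of regular closed
   sets closed, so the 0-1 valued indicator of nonmembership is a countable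
   kappa-metric.  Conversely, well-order T; the closed initial segments outside
   U form a chain of clopen sets missing the point U, whose union belongs to U.
   Under (K4) their distances to U are positive with infimum 0, so countably
   many of them are cofinal in the chain, contradicting countable
   completeness. *)

Set Implicit Arguments.
Unset Strict Implicit.
Unset Printing Implicit Defensive.

Import Order.TTheory GRing.Theory Num.Theory.
Import numFieldNormedType.Exports.

Local Open Scope classical_set_scope.
Local Open Scope ring_scope.
Local Open Scope card_scope.

Lemma free_ultra_set1 (T : Type) (F : set_system T) (t : T) :
  UltraFilter F -> free_filter F -> ~ F [set t].
Proof.
move=> FU free Ft; suff : set0 t by [].
rewrite -free => D FD; apply: contrapT => nDt.
apply: (filter_not_empty F); apply: filterS (filterI Ft FD).
by move=> s [-> /nDt].
Qed.

(** Otherwise the complements form a countable family in [F], strictly smaller than the uncountable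
    [T]; completeness puts their intersection, which misses the union, in [F]. *)
Lemma tau_complete_bigcup (T : Type) (F : set_system T) (A : nat -> set T) :
  UltraFilter F -> ~ countable [set: T] -> tau_complete F ->
  F (\bigcup_n A n) -> exists n, F (A n).
Proof.
move=> FU Tunc Fcomp FA; apply: contrapT => /forallNP nFA.
pose B := range (fun n => ~` A n).
have Bcount : countable B := card_image_le _ _.
have FB : F (\bigcap_(D in B) D).
  apply: Fcomp => [_ [n _ <-]|].
    by have [/nFA|] := in_ultra_setVsetC (A n) FU.
  split=> [|TB]; last by apply: Tunc; exact: card_le_trans TB Bcount.
  apply: card_le_trans Bcount _; apply/infiniteP => Tfin.
  by apply: Tunc; exact: finite_set_countable.
apply: (filter_not_empty F); apply: filterS (filterI FA FB).
by move=> t [[n _ Ant] /(_ (~` A n))]; apply=> //; exists n.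
Qed.

Section WellOrder.
Context (T : Type) (le : rel T).
Hypothesis le_wo : wochoice.well_order le.

Lemma well_order_min (P : set T) :
  P !=set0 -> exists2 m, P m & forall x, P x -> le m x.
Proof.
move=> [x Px].
have [|m [[Pm lem] _]] := le_wo (A := [pred z | `[< P z >]]).
  by exists x; apply/asboolP.
by exists m => [|y Py]; [exact/asboolP|apply: lem; exact/asboolP].
Qed.

Lemma well_order_total (x y : T) : le x y \/ le y x.
Proof.
have [|m [->|->] lem] := @well_order_min [set x; y]; first by exists x; left.
  by left; apply: lem; right.
by right; apply: lem; left.
Qed.

(** [well_order] asks for a unique minimum in every nonempty set; on the pair of [x] and [y] both
    points would be minimal. *)
Lemma well_order_anti (x y : T) : le x y -> le y x -> x = y.
Proof.
move=> xy yx; have xx : le x x by have [] := well_order_total x x.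
have yy : le y y by have [] := well_order_total y y.
have [|m [_ mU]] := le_wo (A := [pred z | `[< z = x \/ z = y >]]).
  by exists x; apply/asboolP; left.
rewrite -(mU x) ?(mU y) //; split; try by move=> z /asboolP[] ->.
  by apply/asboolP; right.
by apply/asboolP; left.
Qed.

(** The minimum of the three points is [x], or else antisymmetry merges two of them. *)
Lemma well_order_trans (x y z : T) : le x y -> le y z -> le x z.
Proof.
move=> xy yz.
have [|m + lem] := @well_order_min [set t | [\/ t = x, t = y | t = z]].
  by exists x; constructor 1.
have [xm ym zm] : [/\ le m x, le m y & le m z].
  by split; apply: lem; [constructor 1|constructor 2|constructor 3].
case=> mE; rewrite mE in xm ym zm => //.
- by rewrite (well_order_anti xy xm).
- by rewrite -(well_order_anti yz ym) in xy *.
Qed.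

End WellOrder.

(* For le a well-order of T, the chain consists of the closed initial segments
   outside F, indexed by their endpoints.  If their union J were not in F, let m
   be the least element of ~` J: then the segment of m is in F and meets
   ~` J only in m, so [set m] would be in F. *)
Lemma free_ultra_chain (T : Type) (F : set_system T) :
  UltraFilter F -> free_filter F ->
  exists (I : Type) (le : rel I) (A : I -> set T),
    [/\ wochoice.well_order le, forall i j, le i j -> A i `<=` A j,
        forall i, ~ F (A i) & F (\bigcup_i A i)].
Proof.
move=> FU free.
have [le le_wo] := wochoice.well_ordering_principle {classic T}.
pose seg (t : T) : set T := [set s | le s t].
pose J : set T := [set t | ~ F (seg t)].
have le_refl t : le t t by have [] := well_order_total le_wo t t.
have FJ : F J.
  have [//|FnJ] := in_ultra_setVsetC J FU.
  have [m nJm min_m] := well_order_min le_wo (filter_ex FnJ).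
  case: nJm => Fm; apply: (free_ultra_set1 (t := m) FU free).
  apply: filterS (filterI Fm FnJ) => s [sm /min_m ms].
  exact: well_order_anti le_wo _ _ sm ms.
exists {t : T | J t}, (fun i j => le (sval i) (sval j)), (fun i => seg (sval i)).
split=> [|i j ij s si|[t Jt] //|].
- move=> B [[t Jt] Bt].
  (* The minimum is found in [T], among the points underlying [B], and then lifted back to the
     subtype. *)
  pose P := [set s | exists Js : J s, (exist _ s Js) \in B].
  have [|m [Jm Bm] min_m] := @well_order_min _ _ le_wo P; first by exists t, Jt.
  exists (exist _ m Jm); split.
    by split=> // -[s Js] Bs; apply: min_m; exists Js.
  move=> [s Js] [Bs min_s]; apply: eq_exist.
  apply: (well_order_anti le_wo); first by apply: min_m; exists Js.
  exact: (min_s (exist _ m Jm)).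
- exact: well_order_trans le_wo _ _ _ si ij.
- by apply: filterS FJ => t Jt; exists (exist _ t Jt) => //; exact: le_refl.
Qed.

(** * Neighbourhoods, closures and regular closed sets in the space *)

Section AdjoinUltra.
Context (T : Type) (U : betaT T).
Local Notation X := (adjoin_ultra U).

Definition adjoin_iso (t : T) : X :=
  SigSub (mem_set (or_introl (imageT (@principal T) t))).

Definition adjoin_lim : X := SigSub (mem_set (or_intror (erefl U))).

Definition adjoin_base (D : set T) : set X := [set x | beta_base D (set_val x)].

Lemma adjoinP (x : X) : (exists t, x = adjoin_iso t) \/ x = adjoin_lim.
Proof.
have [[t _ tx]|xU] : adjoin_ultra U (set_val x) by exact: set_valP.
  by left; exists t; apply/val_inj.
by right; apply/val_inj.
Qed.

Lemma adjoin_base_iso (D : set T) (t : T) : adjoin_base D (adjoin_iso t) <-> D t.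
Proof. exact: principal_filterP. Qed.

Lemma adjoin_base_lim (D : set T) : adjoin_base D adjoin_lim <-> beta_sets U D.
Proof. by []. Qed.

Lemma adjoin_base_open (D : set T) : open (adjoin_base D).
Proof.
exists (beta_base D) => //; exists [set D] => //.
by rewrite bigcup_set1.
Qed.

Lemma nbhs_adjoin (x : X) (S : set X) :
  nbhs x S -> exists2 D, adjoin_base D x & adjoin_base D `<=` S.
Proof.
rewrite nbhsE => -[_ [[_ [I _ <-] <-] [D ID Dx]] sub].
by exists D => // y Dy; apply: sub; exists D.
Qed.

Lemma adjoin_baseC (D : set T) : ~` adjoin_base D = adjoin_base (~` D).
Proof.
apply/seteqP; split=> x; have xU := beta_ultra (set_val x).
  by move=> nDx; have [] := in_ultra_setVsetC D xU.
move=> nDx Dx; apply: (filter_not_empty (set_val x)).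
by apply: filterS (filterI Dx nDx) => t [].
Qed.

Lemma adjoin_base_regclosed (D : set T) : regclosed (adjoin_base D).
Proof.
rewrite /regclosed (interior_id _).1; last exact: adjoin_base_open.
apply/esym/closure_id; rewrite -openC adjoin_baseC.
exact: adjoin_base_open.
Qed.

Hypothesis free : free_filter U.

Lemma adjoin_base1 (t : T) : adjoin_base [set t] = [set adjoin_iso t].
Proof.
apply/seteqP; split=> [x|_ ->]; last exact/adjoin_base_iso.
have [[s ->] /adjoin_base_iso ->//|-> /adjoin_base_lim Ut] := adjoinP x.
by have := free_ultra_set1 (beta_ultra U) free Ut.
Qed.

Lemma closure_adjoin_iso (S : set X) (t : T) :
  closure S (adjoin_iso t) -> S (adjoin_iso t).
Proof.
move=> /(_ [set adjoin_iso t])[]; last by move=> _ [] /[swap] ->.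
apply: open_nbhs_nbhs; split=> //; rewrite -adjoin_base1.
exact: adjoin_base_open.
Qed.

(** If the trace of [S] is not in [U], its complement is, and yields a neighbourhood of [adjoin_lim]
    that can meet [S] only in [adjoin_lim]. *)
Lemma closure_adjoin_lim (S : set X) :
  closure S adjoin_lim -> S adjoin_lim \/ beta_sets U (@adjoin_iso @^-1` S).
Proof.
move=> clS; have [|UnS] := in_ultra_setVsetC (@adjoin_iso @^-1` S) (beta_ultra U).
  by right.
have /clS[x []] : nbhs adjoin_lim (adjoin_base (~` (@adjoin_iso @^-1` S))).
  apply: open_nbhs_nbhs; split; first exact: adjoin_base_open.
  exact/adjoin_base_lim.
have [[t ->] St /adjoin_base_iso//|-> ? _] := adjoinP x.
by left.
Qed.

Lemma adjoin_lim_closure (S : set X) :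
  beta_sets U (@adjoin_iso @^-1` S) -> closure S adjoin_lim.
Proof.
move=> US N /nbhs_adjoin[D /adjoin_base_lim UD subN].
have UU := beta_ultra U.
have [t [St Dt]] := filter_ex (filterI US UD).
by exists (adjoin_iso t); split=> //; apply/subN/adjoin_base_iso.
Qed.

(** Regularity puts [adjoin_lim] in the closure of the interior of [C]: either it is interior, so a
    basic neighbourhood lies in [C], or the trace of the interior is in [U]. *)
Lemma regclosed_adjoin_lim (C : set X) :
  regclosed C -> C adjoin_lim -> beta_sets U (@adjoin_iso @^-1` C).
Proof.
move=> rC; have UU := beta_ultra U; rewrite -{1}rC.
move=> /closure_adjoin_lim[/nbhs_adjoin[D /adjoin_base_lim UD subC]|].
  by apply: filterS UD => t /adjoin_base_iso /subC.
by apply: filterS => t; exact: interior_subset.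
Qed.

Lemma regclosed_adjoinE (C : set X) :
  regclosed C -> C = adjoin_base (@adjoin_iso @^-1` C).
Proof.
move=> rC; apply/seteqP; split=> x; have [[t ->]|->] := adjoinP x.
- by move=> Ct; exact/adjoin_base_iso.
- exact: regclosed_adjoin_lim.
- by move=> /adjoin_base_iso.
- have clC : closed C by rewrite -rC; exact: closed_closure.
  by move=> /adjoin_base_lim /adjoin_lim_closure /clC.
Qed.

Hypothesis (Tunc : ~ countable [set: T]) (Ucomp : tau_complete U).

(** A new point of the closure could only be [adjoin_lim]; then the union of the traces is in [U],
    hence so is one trace, and that [C n] already contains the point. *)
Lemma closure_bigcup_adjoin (C : nat -> set X) :
  (forall n, regclosed (C n)) -> closure (\bigcup_n C n) = \bigcup_n C n.
Proof.
move=> rC; apply/seteqP; split; last exact: subset_closure.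
move=> x; have [[t ->]|->] := adjoinP x; first exact: closure_adjoin_iso.
move=> /closure_adjoin_lim[//|]; rewrite preimage_bigcup => UC.
have [n UCn] := tau_complete_bigcup (beta_ultra U) Tunc Ucomp UC.
exists n => //; rewrite (regclosed_adjoinE (rC n)); exact/adjoin_base_lim.
Qed.

Lemma adjoin_countably_kappa_metrizable (R : realType) :
  countably_kappa_metrizable R X.
Proof.
pose rho (x : X) (C : set X) : R := (x \notin C)%:R.
have rho_ge0 x C : 0 <= rho x C by exact: ler0n.
have rho0 x C : rho x C = 0 <-> C x.
  rewrite /rho; split=> [/eqP|/mem_set->//].
  by rewrite pnatr_eq0 eqb0 negbK => /set_mem.
have rho1 x C : ~ C x -> rho x C = 1.
  by move=> nCx; rewrite /rho memNset.
exists rho; split.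
  split=> // [x C D _ _ CD|C rC x].
    have [Cx|nCx] := pselect (C x); last by rewrite (rho1 _ _ nCx) lern1 leq_b1.
    by rewrite (iffRL (rho0 x D)) //; exact: CD.
  (* [C] and its complement are both open, so the distance to [C] is locally constant. *)
  have rCE := regclosed_adjoinE rC.
  have [Cx|nCx] := pselect (C x).
    apply: (@near_cst_continuous _ _ (0 : R)).
    have : open C by rewrite rCE; exact: adjoin_base_open.
    move=> oC; have : nbhs x C by exact: open_nbhs_nbhs.
    by apply: filterS => y Cy; exact/rho0.
  apply: (@near_cst_continuous _ _ (1 : R)).
  have : open (~` C) by rewrite rCE adjoin_baseC; exact: adjoin_base_open.
  move=> oC; have : nbhs x (~` C) by exact: open_nbhs_nbhs.
  by apply: filterS => y /rho1.
move=> C rC _ x; rewrite closure_bigcup_adjoin//.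
have [[n _ Cnx]|nCx] := pselect ((\bigcup_n C n) x).
  rewrite (iffRL (rho0 x _)); last by exists n.
  apply/eqP; rewrite eq_le; apply/andP; split.
    by apply: lb_le_inf => [|_ [m _ <-]]; [exists (rho x (C n)), n|].
  apply: ge_inf; first by exists 0 => _ [m _ <-].
  by exists n => //; exact/rho0.
(* Outside the union every distance is 1; index 0 shows that the value 1 is attained. *)
rewrite rho1// (_ : [set _ | _ in _] = [set 1]) ?inf1//.
apply/seteqP; split=> [_ [n _ <-]|_ ->]; last (exists 0%N => //).
  by apply: rho1 => Cnx; apply: nCx; exists n.
by apply: rho1 => Cnx; apply: nCx; exists 0%N.
Qed.

Lemma adjoin_not_kappa_metrizable (R : realType) : ~ kappa_metrizable R X.
Proof.
move=> [rho [[rho_ge0 rho0 rho_anti _] rho_inf]]; have UU := beta_ultra U.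
have [I [le [A [le_wo le_sub nUA UA]]]] := free_ultra_chain UU free.
have [t0 [i0 _ _]] := filter_ex UA.
pose r i := rho adjoin_lim (adjoin_base (A i)).
have base_sub i j : A i `<=` A j -> adjoin_base (A i) `<=` adjoin_base (A j).
  move=> sub x; have xU := beta_ultra (set_val x); exact: filterS sub.
have r_gt0 i : 0 < r i.
  rewrite lt_neqAle rho_ge0 ?andbT; last exact: adjoin_base_regclosed.
  apply/eqP => /esym/(rho0 _ _ (adjoin_base_regclosed _)); exact: nUA.
(* (K4) equates the infimum with the distance to the closure of the union, which is 0 because the
   union of the traces is in [U]. *)
have r_inf : inf [set r i | i in setT] = 0.
  rewrite -(rho_inf I le)//; first last.
  - by move=> i j /le_sub; exact: base_sub.
  - by move=> i; exact: adjoin_base_regclosed.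
  - by exists i0.
  have clU : open (\bigcup_i adjoin_base (A i)).
    by apply: bigcup_open => i _; exact: adjoin_base_open.
  apply/rho0; first exact: closure_open_regclosed.
  apply: adjoin_lim_closure; apply: filterS UA => t [i _ Ait].
  by exists i => //; exact/adjoin_base_iso.
have small n : exists i, r i < n.+1%:R^-1.
  have : inf [set r i | i in setT] < n.+1%:R^-1 by rewrite r_inf invr_gt0.
  move=> /inf_lt[|_ [i _ <-]]; last by exists i.
  by exists (r i0), i0.
have [f r_small] := choice small.
(* Countable completeness keeps the chosen countable union out of [U], so some [t] in some [A i]
   escapes it. *)
have nUf : ~ beta_sets U (\bigcup_n A (f n)).
  by move=> /(tau_complete_bigcup UU Tunc Ucomp)[n]; exact: nUA.
have UnF : beta_sets U (~` \bigcup_n A (f n)).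
  by have [/nUf|] := in_ultra_setVsetC (\bigcup_n A (f n)) UU.
have [t [[i _ Ait] nAft]] := filter_ex (filterI UA UnF).
(* By totality [A i] contains every [A (f n)], as [t] lies in none of them; so (K2) bounds the
   positive [r i] by every 1/(n+1). *)
have r_le n : r i <= r (f n).
  apply: rho_anti; [exact: adjoin_base_regclosed..|apply: base_sub].
  have [/le_sub Aif|/le_sub//] := well_order_total le_wo i (f n).
  by case: nAft; exists n => //; exact: Aif.
have [n] := ltr_add_invr (r_gt0 i); rewrite add0r.
by move=> /lt_trans/(_ (le_lt_trans (r_le n) (r_small n))); rewrite ltxx.
Qed.

End AdjoinUltra.

Theorem theorem2p4 (R : realType) (T : Type) (U : betaT T) :
  measurable_cardinal T -> tau_complete U -> free_filter U ->
  countably_kappa_metrizable R (adjoin_ultra U) /\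
  ~ kappa_metrizable R (adjoin_ultra U).
Proof.
move=> [Tunc _] Ucomp free; split.
  exact: adjoin_countably_kappa_metrizable.
exact: adjoin_not_kappa_metrizable.
Qed.
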